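(* Let $q$ be a nonzero complex number with $|q|<1$, let $m$ be a nonnegative integer, and let $a,b,c,d,z$ be complex parameters such that all expressions below are well defined (no division by zero occurs). If $|z|<1$ and $|cd/abz|<1$, then $$ \sum_{k=-m}^{\infty}\frac{(a,b;q)_k\,(cdq^m/abz;q)_k}{(c,d;q)_k\,(q^{1+m};q)_k}\,z^k= \frac{(az,bz,cd/abz;q)_{\infty}}{(c,d,z;q)_{\infty}}\cdot\frac{(cq/abz,\,dq/abz,\,z;q)_m}{(q/a,\,q/b,\,cd/abz;q)_m} \sum_{k=-m}^{\infty}\frac{(abz/c,\,abz/d,\,zq^m;q)_{k}}{(az,\,bz,\,q^{1+m};q)_{k}}\left(\frac{cd}{abz}\right)^{k}. $$
   Context: For $|q|<1$, $(x;q)_\infty=\prod_{i\ge 0}(1-xq^i)$, and for any integer $n$, $(x;q)_n=(x;q)_\infty/(xq^n;q)_\infty$. Thus for $n\ge 0$, $(x;q)_n=\prod_{i=0}^{n-1}(1-xq^i)$ and $(x;q)_{-n}=\dfrac{1}{(xq^{-n};q)_n}=\dfrac{(-q/x)^n q^{\binom n2}}{(q/x;q)_n}$. Multi-parameter notation: $(x_1,\ldots,x_r;q)_n=(x_1;q)_n\cdots(x_r;q)_n$ for $n$ an integer or $\infty$. Expressions such as $cd/abz$ mean $cd/(abz)$, and similarly $cdq^m/abz=cdq^m/(abz)$, $cq/abz=cq/(abz)$, $dq/abz=dq/(abz)$, while $abz/c=(abz)/c$ and $abz/d=(abz)/d$. *)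

(* Defs.v *)
From HB Require Import structures.
From mathcomp Require Import all_boot all_order all_algebra.
From mathcomp Require Import complex.
From mathcomp Require Import all_classical all_reals all_analysis.

Set Implicit Arguments.
Unset Strict Implicit.
Unset Printing Implicit Defensive.

Import Order.TTheory GRing.Theory Num.Theory.
Import numFieldNormedType.Exports.

Local Open Scope classical_set_scope.
Local Open Scope ring_scope.

Section QPochhammer.
Variable K : numFieldType.
Implicit Types (x q : K) (xs num den : seq K) (f : int -> K).

Definition qpochn x q (n : nat) : K := \prod_(i < n) (1 - x * q ^+ i).

Definition qpochoo x q : K := limn (qpochn x q).

(* For n < 0 this is (x;q)_n = 1 / (x q^n; q)_(-n); note Negz n = - n.+1. *)
Definition qpoch x q (n : int) : K :=
  match n with
  | Posz n => qpochn x q n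
  | Negz n => (qpochn (x * q ^ (Negz n)) q n.+1)^-1
  end.

(* No division by zero occurs in (x;q)_n. *)
Definition qpoch_def x q (n : int) : bool :=
  match n with
  | Posz _ => true
  | Negz n => qpochn (x * q ^ (Negz n)) q n.+1 != 0
  end.

Definition qpochs xs q (n : int) : K := \prod_(x <- xs) qpoch x q n.

Definition qpochoos xs q : K := \prod_(x <- xs) qpochoo x q.

Definition qratio num den q (n : int) : K := qpochs num q n / qpochs den q n.

(* No division by zero occurs in qratio num den q n, including inside the
   individual symbols (x;q)_n with n < 0. *)
Definition qratio_def num den q (n : int) : bool :=
  [&& all (fun x => qpoch_def x q n) num,
      all (fun x => qpoch_def x q n) den
    & qpochs den q n != 0].

Definition zseries (s : int) f : nat -> K := series (fun n => f (s + n%:Z)).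

Definition zsummable (s : int) f : Prop := cvgn (zseries s f).

(* \sum_(k = s)^oo f k *)
Definition zsum (s : int) f : K := limn (zseries s f).

Lemma qpochnD x q n N :
  qpochn x q (n + N) = qpochn x q n * qpochn (x * q ^+ n) q N.
Proof.
rewrite /qpochn big_split_ord /=; congr (_ * _).
by apply: eq_bigr => i _; rewrite exprD mulrA.
Qed.

Lemma cvg_qpochnD x q n (l : K) : qpochn (x * q ^+ n) q N @[N --> \oo] --> l ->
  qpochn x q N @[N --> \oo] --> qpochn x q n * l.
Proof.
move=> h; rewrite -(cvg_shiftn n).
under eq_fun do rewrite addnC qpochnD.
exact: cvgMl_tmp.
Qed.

(* (x;q)_n = (x;q)_oo / (x q^n;q)_oo for every integer n. *)
Lemma qpochE x q (n : int) : q != 0 ->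
  cvgn (qpochn (x * q ^ n) q) -> qpochoo (x * q ^ n) q != 0 ->
  qpoch x q n = qpochoo x q / qpochoo (x * q ^ n) q.
Proof.
move=> q0; case: n => n cv nz /=.
  have /cvg_lim := @cvg_qpochnD x q n _ cv.
  by rewrite /qpochoo => ->; rewrite ?mulfK.
set y := x * q ^ (Negz n) in cv nz *.
have yq : y * q ^+ n.+1 = x by rewrite /y NegzE -exprnN mulfVK // expf_neq0.
have yD N : qpochn y q (n.+1 + N) = qpochn y q n.+1 * qpochn x q N.
  by rewrite qpochnD yq.
have yl : qpochn y q (n.+1 + N) @[N --> \oo] --> qpochoo y q.
  under eq_fun do rewrite addnC.
  have := cv; rewrite /qpochoo -(cvg_shiftn n.+1); exact.
have Q0 : qpochn y q n.+1 != 0.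
  apply: contra_neq nz => Q0.
  apply: (cvg_unique _ yl); first exact: norm_hausdorff.
  by rewrite /=; under eq_fun do rewrite yD Q0 mul0r; apply: cvg_cst.
have xl : qpochn x q N @[N --> \oo] --> (qpochn y q n.+1)^-1 * qpochoo y q.
  have -> : qpochn x q = fun N => (qpochn y q n.+1)^-1 * qpochn y q (n.+1 + N).
    by apply/funext => N; rewrite yD mulKf.
  exact: cvgMl_tmp.
have -> : qpochoo x q = (qpochn y q n.+1)^-1 * qpochoo y q.
  exact/cvg_lim/xl/norm_hausdorff.
by rewrite mulfK.
Qed.

End QPochhammer.

(* Main.v *)
Require Import Defs.
From HB Require Import structures.
From mathcomp Require Import all_boot all_order all_algebra.
From mathcomp Require Import complex ring.
From mathcomp Require Import all_classical all_reals all_analysis.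

Set Implicit Arguments.
Unset Strict Implicit.
Unset Printing Implicit Defensive.

Import Order.TTheory GRing.Theory Num.Theory.
Import numFieldNormedType.Exports.

Local Open Scope classical_set_scope.
Local Open Scope ring_scope.

(** Substituting [k = n - m] turns both sums into ordinary
    basic hypergeometric series.  With
      [A = a q^-m], [B = b q^-m], [e = cd/abz], [P = c q^-m / e], [Q = d q^-m / e]
    the left side is a constant times the 3phi2 series with numerators
    [A, B, e], denominators [P e, Q e] and argument [z]; the right side is a
    constant times the one with numerators [P, Q, z], denominators [A z, B z]
    and argument [e].  The parameters satisfy the balance [A B z = P Q e], and
    exchanging [(A, B, z)] with [(P, Q, e)] exchanges the two series.

    The transformation between them ([phi32_transform]) is proved by making this
    symmetry visible.  Write [W n] for [(A,B;q)_n / (q;q)_n] and [W' k] for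
    [(P,Q;q)_k / (q;q)_k].  The q-Gauss sum, in the form
      (Px, Qx; q)_oo / (x; q)_oo = sum_k W' k * x^k * (PQ x q^k; q)_oo,
    which holds for all [|x| < 1] ([qgauss]), is applied with [x = e q^n] to the
    n-th term of the left series.  The result is the double series
      sum_(n,k) W n * W' k * z^n * e^k * q^(nk) * (PQe q^(n+k); q)_oo,
    which is symmetric because [PQe = ABz]; summing it over [n] first and using
    q-Gauss at [x = z q^k] gives the right series ([gauss_double_sum]).

    The q-Gauss sum itself comes from the functional equation
      (1 - x) Phi(x) = (1 - Px) (1 - Qx) Phi(xq)
    of its right-hand side [Phi], which telescopes term by term ([gauss_step]);
    iterating it and letting [x q^N] tend to 0 gives the product.

    All analysis rests on domination by geometric series.  It is carried out
    over any [numFieldType] in which powers of an element of norm less than 1 tend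
    to 0 and geometrically dominated series converge, and the complex numbers
    are such a field.  What remains is to compare constants: the finite factors
    at [q^-m] are turned into those at [q/a], [q/b], [cq/abz], [dq/abz] by reversing
    the product ([qpochn_reflect]). *)

(** * Geometrically dominated series *)

(** The two consequences of completeness and of the archimedean property on which
    the proof relies.  Isolating them allows a field whose norm takes its values
    in the field itself to be treated without separating real parts. *)
Definition geometrically_complete (K : numFieldType) : Prop :=
  (forall t : K, `|t| < 1 -> t ^+ n @[n --> \oo] --> (0 : K)) /\
  (forall (M t : K) (u : nat -> K), `|t| < 1 ->
     (forall n, `|u n| <= M * `|t| ^+ n) -> cvgn (series u)).

Section RealCoordinates.
Variables (R : realType) (K : numFieldType).
Variables (inj : {rmorphism R -> K}) (re im : K -> R) (iota : K).
Hypothesis norm_inj : forall x, `|inj x| = inj `|x|.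
Hypothesis le_inj : {mono inj : x y / x <= y}.
Hypothesis reK : forall x, x \is Num.real -> inj (re x) = x.
Hypothesis coordE : forall x, x = inj (re x) + iota * inj (im x).
Hypothesis norm_re : forall x, inj `|re x| <= `|x|.
Hypothesis norm_im : forall x, inj `|im x| <= `|x|.

Let lt_inj : {mono inj : x y / x < y}.
Proof. exact: leW_mono. Qed.

Let ge0_inj x : (0 <= inj x) = (0 <= x).
Proof. by rewrite -[0 in LHS](rmorph0 inj) le_inj. Qed.

Let lt1_inj x : (inj x < 1) = (x < 1).
Proof. by rewrite -(rmorph1 inj) lt_inj. Qed.

Let cvg_inj (u : nat -> R) (a : R) :
  u n @[n --> \oo] --> a -> inj (u n) @[n --> \oo] --> inj a.
Proof.
move=> ua; apply/cvgrPdist_lt => e e0.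
have er : inj (re e) = e by rewrite reK// gtr0_real.
have re0 : 0 < re e by rewrite -lt_inj er rmorph0.
move/cvgrPdist_lt : ua => /(_ _ re0); apply: filterS => n.
by rewrite -lt_inj er -norm_inj rmorphB.
Qed.

(** Both properties hold over the reals and transfer along the coordinates: a norm
    in [K] is the image of a real number, and each coordinate of a dominated
    sequence is dominated by the same geometric sequence. *)
Lemma coordinates_geometrically_complete : geometrically_complete K.
Proof.
split=> [t t1|M t u t1 uM].
  have tx : inj (re `|t|) = `|t| by rewrite reK.
  have x0 : 0 <= re `|t| by rewrite -ge0_inj tx.
  have x1 : `|re `|t| | < 1 by rewrite ger0_norm // -lt1_inj tx.
  apply/cvgr0Pnorm_lt => e e0.
  have := cvg_inj (cvg_expr x1); rewrite rmorph0 => /cvgr0Pnorm_lt/(_ e e0).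
  by apply: filterS => n; rewrite rmorphXn tx normrX normr_id -normrX.
pose x := re `|t|; pose y := re M.
have tx : inj x = `|t| by rewrite reK.
have M0 : 0 <= M by have := uM 0%N; rewrite expr0 mulr1; apply: le_trans.
have My : inj y = M by rewrite reK// ger0_real.
have x0 : 0 <= x by rewrite -ge0_inj tx.
have x1 : `|x| < 1 by rewrite ger0_norm // -lt1_inj tx.
have y0 : 0 <= y by rewrite -ge0_inj My.
have key (p : nat -> R) : (forall n, `|p n| <= y * x ^+ n) -> cvgn (series p).
  move=> py; apply: normed_cvg; apply: (@series_le_cvg _ _ (geometric y x)) => //.
  - by move=> n /=.
  - by move=> n; rewrite /= mulr_ge0 // exprn_ge0.
  - exact: is_cvg_geometric_series.
have uxy n : `|u n| <= inj (y * x ^+ n) by rewrite rmorphM rmorphXn tx My.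
have /key/cvg_ex[/= a aP] n : `|re (u n)| <= y * x ^+ n.
  by rewrite -le_inj (le_trans _ (uxy n)).
have /key/cvg_ex[/= b bP] n : `|im (u n)| <= y * x ^+ n.
  by rewrite -le_inj (le_trans _ (uxy n)).
apply/cvg_ex; exists (inj a + iota * inj b).
have -> : series u = (fun n => inj (series (re \o u) n)
    + iota * inj (series (im \o u) n)).
  apply/funext => n; rewrite /series /= !rmorph_sum mulr_sumr -big_split /=.
  by apply: eq_bigr => i _; exact: coordE.
apply: cvgD; first exact: cvg_inj.
by apply: cvgMl_tmp; exact: cvg_inj.
Qed.

End RealCoordinates.

Lemma complex_geometrically_complete (R : realType) : geometrically_complete R[i].
Proof.
apply: (@coordinates_geometrically_complete R _ (real_complex R)
  (@complex.Re R) (@complex.Im R) 'i%C).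
- by move=> x; rewrite normc_def /= expr0n /= addr0 sqrtr_sqr.
- exact: lecR.
- by move=> x; exact: RRe_real.
- exact: complexE.
- exact: normc_ge_Re.
- move=> x; have := normc_ge_Re (x * 'i%C); rewrite ReiNIm normrN => /le_trans; apply.
  rewrite normrM [X in _ * X](_ : _ = 1) ?mulr1//.
  by rewrite normc_def /= expr0n expr1n /= add0r sqrtr1.
Qed.

Section GeometricSeries.
Variable C : numFieldType.
Hypothesis C_complete : geometrically_complete C.
Implicit Types (u v : nat -> C) (M r s t : C).

(** The order of [C] is only partial, but [M] is a real element since it bounds a
    norm, so it can be compared with the norm of the limit. *)
Lemma norm_lim_le u (l : C) M :
  u n @[n --> \oo] --> l -> (forall n, `|u n| <= M) -> `|l| <= M.
Proof.
move=> ul uM; have MR : M \is Num.real.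
  by rewrite ger0_real// (le_trans _ (uM 0)).
have [//|lM] := real_leP (normr_real l) MR.
have [n _ /(_ n (leqnn n))] := cvgr_norm_gt _ ul _ lM.
by rewrite /= => /lt_le_trans/(_ (uM n)); rewrite ltxx.
Qed.

Lemma sum_geometric_le t m n : 0 <= t < 1 ->
  \sum_(m <= i < n) t ^+ i <= t ^+ m / (1 - t).
Proof.
move=> /andP[t0 t1]; have t1' : 0 < 1 - t by rewrite subr_gt0.
have [mn|nm] := leqP m n; last first.
  by rewrite big_geq ?(ltnW nm)// divr_ge0 ?exprn_ge0// ltW.
rewrite ler_pdivlMr // -(subnK mn) addnC.
elim: (n - m)%N => [|k IH]; first by rewrite addn0 big_geq // mul0r exprn_ge0.
suff : (\sum_(m <= i < m + k.+1) t ^+ i) * (1 - t) = t ^+ m - t ^+ (m + k.+1).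
  by move=> ->; rewrite gerBl exprn_ge0.
elim: {IH} k.+1 => [|j IH]; first by rewrite addn0 big_geq // mul0r subrr.
rewrite addnS big_nat_recr ?leq_addr //= mulrDl IH exprS; ring.
Qed.

Lemma series_tail_le M t u m : `|t| < 1 ->
  (forall n, `|u n| <= M * `|t| ^+ n) ->
  `|limn (series u) - series u m| <= M * (`|t| ^+ m / (1 - `|t|)).
Proof.
move=> t1 uM; have M0 : 0 <= M by have := uM 0%N; rewrite expr0 mulr1; apply: le_trans.
have cu := C_complete.2 _ _ _ t1 uM.
apply: (@norm_lim_le (fun n => series u (n + m)%N - series u m)).
  by apply: cvgB; [rewrite cvg_shiftn|exact: cvg_cst].
move=> n; rewrite sub_series_geq ?leq_addl // /= (le_trans (ler_norm_sum _ _ _))//.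
apply: le_trans (ler_sum _ _) _ => [i _|]; first exact: uM.
by rewrite -mulr_sumr ler_wpM2l// sum_geometric_le// normr_ge0.
Qed.

Lemma norm_lim_series_le M t u : `|t| < 1 ->
  (forall n, `|u n| <= M * `|t| ^+ n) ->
  `|limn (series u)| <= M / (1 - `|t|).
Proof.
move=> t1 uM; have := series_tail_le 0 t1 uM.
by rewrite /series /= big_geq // subr0 mul1r.
Qed.

(** Fubini for a doubly geometric bound: each iterated sum, truncated at [N],
    differs from the square partial sum over [n, k < N] by at most a constant times
    a geometric tail, so the difference of the two tends to 0. *)
Lemma lim_series_exchange M r s (F : nat -> nat -> C) : `|r| < 1 -> `|s| < 1 ->
  (forall n k, `|F n k| <= M * `|r| ^+ n * `|s| ^+ k) ->
  limn (series (fun n => limn (series (F n)))) =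
  limn (series (fun k => limn (series (F^~ k)))).
Proof.
move=> r1 s1 FM.
have M0 : 0 <= M by have := FM 0%N 0%N; rewrite !mulr1; apply: le_trans.
have FM' n k : `|F n k| <= M * `|s| ^+ k * `|r| ^+ n by rewrite mulrAC.
pose a n := limn (series (F n)); pose b k := limn (series (F^~ k)).
pose c t := (1 - `|t|)^-1.
have c0 t : `|t| < 1 -> 0 <= c t by move=> t1; rewrite invr_ge0 subr_ge0 ltW.
have aM n : `|a n| <= M * c s * `|r| ^+ n.
  by rewrite mulrAC; apply: norm_lim_series_le.
have bM n : `|b n| <= M * c r * `|s| ^+ n.
  by rewrite mulrAC; exact: (@norm_lim_series_le _ _ (F^~ n)).
have ca := C_complete.2 _ _ _ r1 aM.
have cb := C_complete.2 _ _ _ s1 bM.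
pose S N := \sum_(0 <= n < N) series (F n) N.
have aS N : `|series a N - S N| <= M * c r * c s * `|s| ^+ N.
  rewrite /series /S /= -sumrB (le_trans (ler_norm_sum _ _ _))//.
  apply: (@le_trans _ _ (\sum_(0 <= n < N) `|r| ^+ n * (M * (`|s| ^+ N * c s)))).
    apply: ler_sum => n _; rewrite mulrA [_ * M]mulrC.
    exact: (@series_tail_le _ _ (F n)).
  rewrite -mulr_suml [X in _ <= X](_ : _ = c r * (M * (`|s| ^+ N * c s))); last ring.
  apply: ler_wpM2r; first by rewrite !mulr_ge0 ?exprn_ge0 ?c0.
  by rewrite (le_trans (sum_geometric_le _ _ _)) ?normr_ge0 // mul1r.
have bS N : `|series b N - S N| <= M * c r * c s * `|r| ^+ N.
  have -> : S N = \sum_(0 <= k < N) series (F^~ k) N by exact: exchange_big.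
  rewrite /series /= -sumrB (le_trans (ler_norm_sum _ _ _))//.
  apply: (@le_trans _ _ (\sum_(0 <= n < N) `|s| ^+ n * (M * (`|r| ^+ N * c r)))).
    apply: ler_sum => n _; rewrite mulrA [_ * M]mulrC.
    exact: (@series_tail_le _ _ (F^~ n)).
  rewrite -mulr_suml [X in _ <= X](_ : _ = c s * (M * (`|r| ^+ N * c r))); last ring.
  apply: ler_wpM2r; first by rewrite !mulr_ge0 ?exprn_ge0 ?c0.
  by rewrite (le_trans (sum_geometric_le _ _ _)) ?normr_ge0 // mul1r.
apply/eqP; rewrite -subr_eq0; apply/eqP.
have dab : series a N - series b N @[N --> \oo] --> limn (series a) - limn (series b).
  exact: cvgB.
apply: (cvg_unique _ dab); first exact: norm_hausdorff.
pose D := M * c r * c s.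
have D0 : 0 <= D by rewrite !mulr_ge0 ?c0.
have g0 : D * `|s| ^+ N + D * `|r| ^+ N @[N --> \oo] --> (0 : C).
  rewrite -[0](_ : D * 0 + D * 0 = 0); last by rewrite mulr0 addr0.
  by apply: cvgD; apply: cvgMl_tmp; apply: C_complete.1; rewrite normr_id.
apply/cvgr0Pnorm_lt => e e0.
move/cvgr0Pnorm_lt : g0 => /(_ e e0); apply: filterS => N.
have ge0 : 0 <= D * `|s| ^+ N + D * `|r| ^+ N.
  by rewrite addr_ge0// mulr_ge0// exprn_ge0.
apply: le_lt_trans; rewrite [X in _ <= X]ger0_norm//.
have -> : series a N - series b N = (series a N - S N) - (series b N - S N) by ring.
by rewrite (le_trans (ler_normB _ _))// lerD.
Qed.

End GeometricSeries.

(** * Infinite q-products *)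

Section QSeries.
Variables (C : numFieldType) (q : C).
Hypothesis C_complete : geometrically_complete C.
Hypothesis q_lt1 : `|q| < 1.
Implicit Types (x y M a b P Q z e : C) (n k N : nat).

Let q01 : 0 <= `|q| < 1.
Proof. by rewrite normr_ge0. Qed.

Let norm_q_le1 n : `|q ^+ n| <= 1.
Proof. by rewrite normrX exprn_ile1// ltW. Qed.

Lemma qpochn0 x : qpochn x q 0 = 1.
Proof. by rewrite /qpochn big_ord0. Qed.

Lemma qpochnS x n : qpochn x q n.+1 = qpochn x q n * (1 - x * q ^+ n).
Proof. by rewrite /qpochn big_ord_recr. Qed.

(** A bound in the field itself, playing the part of the exponential of the sum. *)
Lemma prod1D_le (u : nat -> C) n : (forall i, 0 <= u i) ->
  (\sum_(i < n) u i) *+ 2 <= 1 ->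
  \prod_(i < n) (1 + u i) <= 1 + (\sum_(i < n) u i) *+ 2.
Proof.
move=> u0; elim: n => [|n IH]; first by rewrite !big_ord0 mul0rn addr0.
rewrite !big_ord_recr /= => s1.
have s1' : (\sum_(i < n) u i) *+ 2 <= 1.
  by apply: le_trans s1; rewrite ler_pMn2r// lerDl.
apply: le_trans (ler_wpM2r _ (IH s1')) _; first by rewrite addr_ge0.
rewrite -subr_ge0; set S := \sum_(i < n) u i.
have -> : 1 + (S + u n) *+ 2 - (1 + S *+ 2) * (1 + u n) = u n * (1 - S *+ 2) by ring.
by rewrite mulr_ge0// subr_ge0.
Qed.

(** From some index [N] on, the geometric tail has sum at most 1/2, so that the
    remaining factors contribute at most 2 by [prod1D_le]. *)
Lemma prod1D_geometric_bounded y : 0 <= y ->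
  exists M, forall n, \prod_(i < n) (1 + y * `|q| ^+ i) <= M.
Proof.
move=> y0.
have f0 i : 0 <= y * `|q| ^+ i by rewrite mulr_ge0// exprn_ge0.
have q1' : 0 < 1 - `|q| by rewrite subr_gt0.
have [N hN] : exists N, y * `|q| ^+ N *+ 2 <= 1 - `|q|.
  have d0 : 0 < (y + 1) *+ 2 by rewrite pmulrn_lgt0// ltr_wpDl.
  have e0 : 0 < (1 - `|q|) / ((y + 1) *+ 2) by rewrite divr_gt0.
  have /cvgr0Pnorm_lt/(_ _ e0)[N _ /(_ N (leqnn N))/=] := C_complete.1 q q_lt1.
  rewrite ltr_pdivlMr// normrX => h; exists N.
  apply: le_trans (ltW h); rewrite -mulrnAl mulrC; apply: ler_wpM2l; first exact: exprn_ge0.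
  by rewrite ler_pMn2r// lerDl.
exists (\prod_(i < N) (1 + y * `|q| ^+ i) * 2) => n.
have D1 i : 1 <= 1 + y * `|q| ^+ i by rewrite lerDl.
have D0 i : 0 <= 1 + y * `|q| ^+ i by rewrite (le_trans _ (D1 i)).
apply: (@le_trans _ _ (\prod_(i < N + n) (1 + y * `|q| ^+ i))).
  rewrite addnC big_split_ord /= ler_peMr ?prodr_ge0//.
  by elim/big_rec: _ => // i p _ p1; rewrite mulr_ege1.
rewrite big_split_ord /=; apply: ler_wpM2l; first exact: prodr_ge0.
have sle : (\sum_(i < n) y * `|q| ^+ (N + i)) *+ 2 <= 1.
  under eq_bigr do rewrite exprD mulrA.
  rewrite -mulr_sumr -mulrnAl.
  apply: le_trans (ler_wpM2r _ hN) _; first by apply: sumr_ge0 => i _; exact: exprn_ge0.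
  have := sum_geometric_le 0 n q01; rewrite mul1r big_mkord => h.
  by apply: le_trans (ler_wpM2l (ltW q1') h) _; rewrite divff// gt_eqF.
apply: le_trans (@prod1D_le (fun i => y * `|q| ^+ (N + i)) n _ sle) _ => //.
by rewrite lerD2l.
Qed.

Lemma qpochn_bounded y : 0 <= y ->
  exists M, forall x n, `|x| <= y -> `|qpochn x q n| <= M.
Proof.
move=> /prod1D_geometric_bounded[M hM]; exists M => x n xy.
apply: le_trans (hM n); rewrite /qpochn normr_prod; apply: ler_prod => i _.
rewrite normr_ge0 /= (le_trans (ler_normB _ _))// normr1 lerD2l normrM normrX.
by rewrite ler_wpM2r// exprn_ge0.
Qed.

(** Telescoping the partial products makes their convergence a matter of
    geometrically dominated series. *)
Lemma qpochn_series x :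
  qpochn x q = (fun n => 1 + series (fun i => - x * q ^+ i * qpochn x q i) n).
Proof.
apply/funext; elim=> [|n IH]; first by rewrite qpochn0 /series /= big_geq// addr0.
by rewrite qpochnS seriesSr addrA -IH; ring.
Qed.

Let qpochn_series_le y : 0 <= y -> exists M, forall x i, `|x| <= y ->
  `|- x * q ^+ i * qpochn x q i| <= M * `|x| * `|q| ^+ i.
Proof.
move=> /qpochn_bounded[M hM]; exists M => x i xy.
rewrite normrM mulrC normrM normrN normrX -[X in _ <= X]mulrA.
by rewrite ler_wpM2r ?mulr_ge0 ?exprn_ge0 ?hM.
Qed.

Lemma is_cvg_qpochn x : cvgn (qpochn x q).
Proof.
have [M /(_ x _ (lexx _)) hM] := qpochn_series_le (normr_ge0 x).
rewrite qpochn_series; apply: is_cvgD; first exact: is_cvg_cst.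
exact: C_complete.2 q_lt1 hM.
Qed.

Lemma qpochoo_near1 y : 0 <= y ->
  exists M, forall x, `|x| <= y -> `|qpochoo x q - 1| <= M * `|x|.
Proof.
move=> /qpochn_series_le[M hM]; exists (M / (1 - `|q|)) => x xy.
rewrite mulrAC; apply: (@norm_lim_le _ (fun n => qpochn x q n - 1)).
  by apply: cvgB; [exact: is_cvg_qpochn|exact: cvg_cst].
move=> n; rewrite qpochn_series addrC addKr.
apply: le_trans (ler_norm_sum _ _ _) _.
apply: le_trans (ler_sum _ _) _ => [i _|]; first exact: hM.
rewrite -mulr_sumr ler_wpM2l//; last first.
  by rewrite (le_trans (sum_geometric_le _ _ q01))// mul1r.
by have /(le_trans (normr_ge0 _)) := hM x 0%N xy; rewrite expr0 mulr1.
Qed.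

Lemma qpochoo_bounded y : 0 <= y ->
  exists M, forall x, `|x| <= y -> `|qpochoo x q| <= M.
Proof.
move=> /qpochn_bounded[M hM]; exists M => x xy.
apply: (@norm_lim_le _ (qpochn x q)) => [|n]; first exact: is_cvg_qpochn.
exact: hM.
Qed.

Lemma qpochooD x n : qpochoo x q = qpochn x q n * qpochoo (x * q ^+ n) q.
Proof.
by apply/cvg_lim; [exact: norm_hausdorff|exact/cvg_qpochnD/is_cvg_qpochn].
Qed.

Lemma qpochooS x : qpochoo x q = (1 - x) * qpochoo (x * q) q.
Proof. by rewrite (qpochooD x 1) qpochnS qpochn0 mul1r mulr1 expr1. Qed.

Lemma one_sub_qexp_neq0 x n : `|x| < 1 -> 1 - x * q ^+ n != 0.
Proof.
move=> x1; apply/eqP => /eqP; rewrite subr_eq0 => /eqP h.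
have : `|x * q ^+ n| < 1.
  by rewrite normrM (le_lt_trans _ x1)// ler_piMr.
by rewrite -h normr1 ltxx.
Qed.

Lemma qpochn_neq0 x n : `|x| < 1 -> qpochn x q n != 0.
Proof. by move=> x1; apply/prodf_neq0 => i _; exact: one_sub_qexp_neq0. Qed.

(** The inverses of the partial products are bounded, because
    [1 / (1 - t) = 1 + t / (1 - t)] and [|t|] is at most [|x| |q|^i] in the i-th factor;
    hence the partial products cannot tend to 0. *)
Lemma qpochoo_neq0 x : `|x| < 1 -> qpochoo x q != 0.
Proof.
move=> x1; have x1' : 0 < 1 - `|x| by rewrite subr_gt0.
have [M hM] : exists M, forall n,
    \prod_(i < n) (1 + `|x| / (1 - `|x|) * `|q| ^+ i) <= M.
  by apply: prod1D_geometric_bounded; rewrite divr_ge0 // ltW.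
have M1 : 1 <= M by have := hM 0%N; rewrite big_ord0.
have M0 : 0 < M by rewrite (lt_le_trans _ M1).
have invM n : `|(qpochn x q n)^-1| <= M.
  apply: le_trans (hM n); rewrite normfV /qpochn normr_prod -prodfV.
  apply: ler_prod => i _; rewrite invr_ge0 normr_ge0 /=.
  set t := x * q ^+ i; have tx : `|t| <= `|x| by rewrite normrM ler_piMr.
  have t1 : 0 < 1 - `|t| by rewrite subr_gt0 (le_lt_trans tx).
  have d1 : 1 - `|t| <= `|1 - t| by rewrite -[X in X - _]normr1 lerB_dist.
  apply: (@le_trans _ _ (1 - `|t|)^-1).
    by rewrite lef_pV2// posrE (lt_le_trans t1).
  have -> : (1 - `|t|)^-1 = 1 + `|t| / (1 - `|t|).
    by apply: (mulIf (lt0r_neq0 t1)); rewrite mulrDl mulVf ?divfK ?lt0r_neq0//; ring.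
  have te : `|t| = `|x| * `|q| ^+ i by rewrite normrM normrX.
  rewrite lerD2l {1}te mulrAC ler_wpM2r ?exprn_ge0//.
  by rewrite ler_wpM2l// lef_pV2 ?posrE// lerD2l lerN2.
apply/eqP => x0.
have c0 : M * qpochn x q n @[n --> \oo] --> (0 : C).
  by rewrite -[X in _ --> X](mulr0 M) -x0; apply: cvgMl_tmp; exact: is_cvg_qpochn.
have /cvgr0Pnorm_lt/(_ _ ltr01)[n _ /(_ n (leqnn n))] := c0.
rewrite /= normrM gtr0_norm// => lt1.
have := invM n; rewrite normfV invf_ple ?posrE ?normr_gt0 ?qpochn_neq0// => h.
by move: lt1; rewrite -ltr_pdivlMl// mulr1 => /(le_lt_trans h); rewrite ltxx.
Qed.

(** Only finitely many factors lie outside the range of [qpochoo_neq0]. *)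
Lemma qpochoo_neq0_qpochn x : (forall n, qpochn x q n != 0) -> qpochoo x q != 0.
Proof.
move=> x0.
have /cvgr0Pnorm_lt/(_ _ ltr01)[N _ /(_ N (leqnn N))/=] :
    x * q ^+ n @[n --> \oo] --> (0 : C).
  by rewrite -[X in _ --> X](mulr0 x); apply: cvgMl_tmp; exact: C_complete.1.
by move=> h; rewrite (qpochooD x N) mulf_neq0// qpochoo_neq0.
Qed.

Lemma qpochnV_bounded x : qpochoo x q != 0 ->
  exists M, forall n, `|(qpochn x q n)^-1| <= M.
Proof.
move=> x0; have [M hM] := qpochoo_bounded (normr_ge0 x).
exists (M / `|qpochoo x q|) => n.
have xn0 : qpochn x q n != 0.
  by move: x0; rewrite (qpochooD x n) mulf_eq0 negb_or => /andP[].
have -> : (qpochn x q n)^-1 = qpochoo (x * q ^+ n) q / qpochoo x q.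
  apply: (mulfI xn0); rewrite mulrA -qpochooD divff// divff//.
by rewrite normrM normfV ler_wpM2r ?invr_ge0// hM// normrM ler_piMr.
Qed.

End QSeries.
(** * The q-Gauss sum and its double series *)

Section QGauss.
Variables (C : numFieldType) (q : C).
Hypothesis C_complete : geometrically_complete C.
Hypothesis q_lt1 : `|q| < 1.
Implicit Types (x y M a b P Q z e : C) (n k N : nat).

Let norm_mul_qexp_le x n : `|x * q ^+ n| <= `|x|.
Proof. by rewrite normrM normrX ler_piMr// exprn_ile1// ltW. Qed.

Lemma lim_series_mull c (u : nat -> C) : cvgn (series u) ->
  limn (series (fun n => c * u n)) = c * limn (series u).
Proof. exact: lim_seriesZ. Qed.

Definition qcoef a b n : C := qpochn a q n * qpochn b q n / qpochn q q n.

Lemma qcoefS a b n : (1 - q ^+ n.+1) * qcoef a b n.+1 =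
  (1 - a * q ^+ n) * (1 - b * q ^+ n) * qcoef a b n.
Proof.
rewrite /qcoef !qpochnS.
have := one_sub_qexp_neq0 q_lt1 n q_lt1; have := qpochn_neq0 q_lt1 n q_lt1.
by rewrite exprS => q0 q1; field; rewrite q0 q1.
Qed.

Lemma qcoef_bounded a b : exists M, forall n, `|qcoef a b n| <= M.
Proof.
have [Ma hMa] := qpochn_bounded C_complete q_lt1 (normr_ge0 a).
have [Mb hMb] := qpochn_bounded C_complete q_lt1 (normr_ge0 b).
have [Mq hMq] := qpochnV_bounded C_complete q_lt1 (qpochoo_neq0 C_complete q_lt1 q_lt1).
exists (Ma * Mb * Mq) => n; rewrite /qcoef !normrM.
by rewrite !ler_pM ?mulr_ge0 ?hMa ?hMb ?hMq.
Qed.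

Definition gauss_term a b x k : C :=
  qcoef a b k * x ^+ k * qpochoo (a * b * x * q ^+ k) q.

(** The bound is uniform on discs, which is what the limit at 0 in
    [gauss_lim_iter] requires. *)
Lemma gauss_term_le a b y : 0 <= y -> exists M, forall x k, `|x| <= y ->
  `|gauss_term a b x k| <= M * `|x| ^+ k.
Proof.
move=> y0; have [M hM] := qcoef_bounded a b.
have [|M' hM'] := @qpochoo_bounded _ _ C_complete q_lt1 (`|a * b| * y).
  exact: mulr_ge0.
exists (M * M') => x k xy; rewrite /gauss_term normrM normrM normrX mulrAC.
rewrite ler_wpM2r ?exprn_ge0// ler_pM ?hM// hM'//.
by rewrite (le_trans (norm_mul_qexp_le _ _))// normrM ler_wpM2l.
Qed.

Lemma is_cvg_gauss a b x : `|x| < 1 -> cvgn (series (gauss_term a b x)).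
Proof.
move=> x1; have [M hM] := gauss_term_le a b (normr_ge0 x).
by apply: (C_complete.2 M x) => // n; exact: hM.
Qed.

Let Phi a b x : C := limn (series (gauss_term a b x)).

(** With [s k] the k-th term times [1 - q^k], the k-th terms of the two sides differ
    by [s k - s k.+1]; moreover [s 0 = 0] and [s k] tends to 0. *)
Lemma gauss_step a b x : `|x| < 1 ->
  (1 - x) * Phi a b x = (1 - a * x) * (1 - b * x) * Phi a b (x * q).
Proof.
move=> x1.
have xq1 : `|x * q| < 1 by rewrite (le_lt_trans _ x1)// -[q]expr1.
have [M hM] := gauss_term_le a b (normr_ge0 x).
pose s k := (1 - q ^+ k) * gauss_term a b x k.
have tele n : (1 - x) * series (gauss_term a b x) n
    - (1 - a * x) * (1 - b * x) * series (gauss_term a b (x * q)) n = - s n.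
  elim: n => [|n IH].
    by rewrite /series /= !big_geq// /s expr0 subrr mul0r !mulr0 subr0 oppr0.
  rewrite !seriesSr [(1 - x) * _]mulrDr [X in _ - X]mulrDr opprD addrACA IH.
  have -> : s n.+1 = (1 - a * q ^+ n) * (1 - b * q ^+ n) * qcoef a b n
      * x ^+ n.+1 * qpochoo (a * b * x * q ^+ n.+1) q.
    by rewrite /s /gauss_term mulrA mulrA qcoefS.
  rewrite /s /gauss_term.
  have -> : a * b * (x * q) * q ^+ n = a * b * x * q ^+ n.+1 by rewrite exprS; ring.
  rewrite (qpochooS C_complete q_lt1 (a * b * x * q ^+ n)).
  have -> : a * b * x * q ^+ n * q = a * b * x * q ^+ n.+1 by rewrite exprSr; ring.
  rewrite exprMn !exprS; ring.
apply/eqP; rewrite -subr_eq0; apply/eqP.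
have lhs : - s n @[n --> \oo]
    --> (1 - x) * Phi a b x - (1 - a * x) * (1 - b * x) * Phi a b (x * q).
  rewrite (_ : (fun n => - s n) = (fun n => (1 - x) * series (gauss_term a b x) n
    - (1 - a * x) * (1 - b * x) * series (gauss_term a b (x * q)) n)).
    by apply: cvgB; apply: cvgMl_tmp; exact: is_cvg_gauss.
  by apply/funext => n; rewrite tele.
apply: (cvg_unique _ lhs); first exact: norm_hausdorff.
rewrite /= -[X in _ --> X]oppr0; apply: cvgN.
have t0 : gauss_term a b x n @[n --> \oo] --> (0 : C).
  exact/cvg_series_cvg_0/is_cvg_gauss.
have q0 : q ^+ n @[n --> \oo] --> (0 : C) by exact: C_complete.1.
rewrite -[X in _ --> X](mulr0 (1 - 0)).
by apply: cvgM t0; apply: cvgB q0; exact: cvg_cst.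
Qed.

Lemma gauss_iter a b x N : `|x| < 1 -> qpochn x q N * Phi a b x =
  qpochn (a * x) q N * qpochn (b * x) q N * Phi a b (x * q ^+ N).
Proof.
move=> x1; elim: N => [|N IH]; first by rewrite !qpochn0 expr0 !mul1r mulr1.
have xN1 : `|x * q ^+ N| < 1 by rewrite (le_lt_trans _ x1).
have := gauss_step a b xN1; rewrite -[x * q ^+ N * q]mulrA -exprSr => step.
rewrite !qpochnS.
transitivity ((qpochn x q N * Phi a b x) * (1 - x * q ^+ N)); first ring.
rewrite IH; transitivity (qpochn (a * x) q N * qpochn (b * x) q N *
  ((1 - x * q ^+ N) * Phi a b (x * q ^+ N))); first ring.
rewrite step; ring.
Qed.

(** The constant term of the series is [(a b y; q)_oo], which is [1 + O(y)], and the
    other terms are together [O(y)], for [|y| <= |x|]. *)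
Lemma gauss_lim_iter a b x : `|x| < 1 ->
  Phi a b (x * q ^+ N) @[N --> \oo] --> (1 : C).
Proof.
move=> x1; have x1' : 0 < 1 - `|x| by rewrite subr_gt0.
have [M hM] := gauss_term_le a b (normr_ge0 x).
have [|M' hM'] := @qpochoo_near1 _ _ C_complete q_lt1 (`|a * b| * `|x|).
  exact: mulr_ge0.
have M0 : 0 <= M.
  by have /(le_trans (normr_ge0 _)) := hM x 0%N (lexx _); rewrite expr0 mulr1.
pose K := M / (1 - `|x|) + M' * `|a * b|.
have near1 y : `|y| <= `|x| -> `|Phi a b y - 1| <= K * `|y|.
  move=> yx; have y1 : `|y| < 1 by rewrite (le_lt_trans yx).
  have -> : Phi a b y - 1 = (Phi a b y - series (gauss_term a b y) 1)
      + (qpochoo (a * b * y) q - 1).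
    rewrite seriesSr [series _ 0]big_geq// add0r /gauss_term /qcoef !qpochn0 expr0.
    by rewrite invr1 !mulr1 mul1r; ring.
  rewrite (le_trans (ler_normD _ _))// /K mulrDl lerD//.
    rewrite (le_trans (series_tail_le C_complete 1 y1 (fun n => hM y n yx)))//.
    rewrite expr1 -mulrA ler_wpM2l// mulrC ler_wpM2r//.
    by rewrite lef_pV2 ?posrE// ?subr_gt0// lerD2l lerN2.
  by rewrite -[X in _ <= X]mulrA -normrM hM'// normrM ler_wpM2l.
have c0 : K * (`|x| * `|q| ^+ n) @[n --> \oo] --> (0 : C).
  rewrite -[X in _ --> X](mulr0 K) -[X in K * X](mulr0 `|x|).
  by do 2!apply: cvgMl_tmp; apply: C_complete.1; rewrite normr_id.
apply/cvgrPdistC_lt => e e0; move/cvgr0Pnorm_lt : c0 => /(_ e e0).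
apply: filterS => n; apply: le_lt_trans.
apply: le_trans (near1 _ (norm_mul_qexp_le _ _)) _.
by rewrite normrM normrX real_ler_norm// ger0_real// -normrX -normrM
  (le_trans _ (near1 _ (norm_mul_qexp_le x n))).
Qed.

(** The q-Gauss sum.  Multiplying the 2phi1 sum with denominator [abx] by
    [(abx; q)_oo] frees it of the condition that this product does not vanish. *)
Lemma qgauss a b x : `|x| < 1 ->
  limn (series (gauss_term a b x)) =
  qpochoo (a * x) q * qpochoo (b * x) q / qpochoo x q.
Proof.
move=> x1; have x0 := qpochoo_neq0 C_complete q_lt1 x1.
apply: (mulIf x0); rewrite divfK// [LHS]mulrC.
have c y : qpochn y q @ \oo --> qpochoo y q by exact: is_cvg_qpochn.
have lhs : qpochn x q N * Phi a b x @[N --> \oo] --> qpochoo x q * Phi a b x.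
  by apply: cvgMr_tmp; exact: c.
apply: (cvg_unique _ lhs); first exact: norm_hausdorff.
rewrite (_ : (fun N => _) = (fun N => qpochn (a * x) q N * qpochn (b * x) q N
    * Phi a b (x * q ^+ N))); last by apply/funext => N; exact: gauss_iter.
rewrite /= -[X in _ --> X]mulr1; apply: cvgM; last exact: gauss_lim_iter.
by apply: cvgM; exact: c.
Qed.

(** Expanding by q-Gauss on either side gives the same double series [F], because
    [a b z] and [P Q e] may be interchanged inside the infinite product. *)
Lemma gauss_double_sum a b P Q z e : `|z| < 1 -> `|e| < 1 ->
  a * b * z = P * Q * e ->
  limn (series (fun n => qcoef a b n * z ^+ n * (qpochoo (P * (e * q ^+ n)) q *
     qpochoo (Q * (e * q ^+ n)) q / qpochoo (e * q ^+ n) q))) =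
  limn (series (fun k => qcoef P Q k * e ^+ k * (qpochoo (a * (z * q ^+ k)) q *
     qpochoo (b * (z * q ^+ k)) q / qpochoo (z * q ^+ k) q))).
Proof.
move=> z1 e1 balanced.
have lt1 x n : `|x| < 1 -> `|x * q ^+ n| < 1 by move=> x1; rewrite (le_lt_trans _ x1).
pose F n k := qcoef a b n * z ^+ n * (qcoef P Q k * e ^+ k) * q ^+ (n * k)
  * qpochoo (P * Q * e * q ^+ (n + k)) q.
have FE n k : F n k = qcoef a b n * z ^+ n * gauss_term P Q (e * q ^+ n) k.
  rewrite /F /gauss_term (_ : P * Q * (e * q ^+ n) * q ^+ k = P * Q * e * q ^+ (n + k)).
    by rewrite exprMn -exprM; ring.
  by rewrite exprD; ring.
have FE' n k : F n k = qcoef P Q k * e ^+ k * gauss_term a b (z * q ^+ k) n.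
  rewrite /F /gauss_term (_ : a * b * (z * q ^+ k) * q ^+ n = P * Q * e * q ^+ (n + k)).
    by rewrite exprMn -exprM mulnC; ring.
  by rewrite exprD -balanced; ring.
transitivity (limn (series (fun n => limn (series (F n))))).
  congr (limn (series _)); apply/funext => n.
  rewrite (_ : F n = (fun k => qcoef a b n * z ^+ n * gauss_term P Q (e * q ^+ n) k)).
    by rewrite lim_series_mull; [rewrite qgauss//; exact: lt1|apply: is_cvg_gauss; exact: lt1].
  by apply/funext => k.
have [M hM] := qcoef_bounded a b; have [M' hM'] := qcoef_bounded P Q.
have [N hN] := qpochoo_bounded C_complete q_lt1 (normr_ge0 (P * Q * e)).
rewrite (@lim_series_exchange _ C_complete (M * M' * N) z e)//; last first.
  move=> n k; rewrite /F; move: (qcoef a b n) (qcoef P Q k) (hM n) (hM' k).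
  move=> u v hu hv; rewrite !normrM !normrX.
  have -> : M * M' * N * `|z| ^+ n * `|e| ^+ k =
    (M * `|z| ^+ n) * (M' * `|e| ^+ k) * 1 * N by ring.
  by rewrite !ler_pM ?mulr_ge0 ?exprn_ge0 ?exprn_ile1 ?hN ?norm_mul_qexp_le// ltW.
congr (limn (series _)); apply/funext => k.
rewrite (_ : F^~ k = (fun n => qcoef P Q k * e ^+ k * gauss_term a b (z * q ^+ k) n)).
  by rewrite lim_series_mull; [rewrite qgauss//; exact: lt1|apply: is_cvg_gauss; exact: lt1].
by apply/funext => n.
Qed.

End QGauss.
(** * The 3phi2 transformation and the shift by m *)

Section Transformation.
Variables (C : numFieldType) (q : C).
Hypothesis C_complete : geometrically_complete C.
Hypothesis q_lt1 : `|q| < 1.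
Implicit Types (x y M a b c d P Q z e : C) (k m n N : nat).

(** The denominators are parametrized as [P e] and [Q e], so that the series on the
    other side of the transformation is obtained by exchanging [(a, b, z)] with
    [(P, Q, e)]. *)
Definition phi32_term a b P Q z e n : C := qcoef q a b n * z ^+ n *
  (qpochn e q n / (qpochn (P * e) q n * qpochn (Q * e) q n)).

Lemma is_cvg_phi32 a b P Q z e : `|z| < 1 ->
  qpochoo (P * e) q != 0 -> qpochoo (Q * e) q != 0 ->
  cvgn (series (phi32_term a b P Q z e)).
Proof.
move=> z1 Pe0 Qe0; have [M hM] := qcoef_bounded C_complete q_lt1 a b.
have [Me hMe] := qpochn_bounded C_complete q_lt1 (normr_ge0 e).
have [Mp hMp] := qpochnV_bounded C_complete q_lt1 Pe0.
have [Mq hMq] := qpochnV_bounded C_complete q_lt1 Qe0.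
apply: (C_complete.2 (M * (Me * (Mp * Mq))) z) => // n.
rewrite /phi32_term invfM; move: (qcoef q a b n) (hM n) => u hu.
rewrite mulrAC !normrM normrX ler_wpM2r ?exprn_ge0//.
by rewrite !ler_pM ?mulr_ge0 ?hMe ?hMp ?hMq.
Qed.

(** The transformation of a nonterminating 3phi2 series listed as (III.10) by Gasper
    and Rahman.  The infinite products absorb the finite symbols with parameters
    [P e], [Q e] and [e], which reduces it to [gauss_double_sum]. *)
Lemma phi32_transform a b P Q z e : `|z| < 1 -> `|e| < 1 ->
  a * b * z = P * Q * e ->
  qpochoo (P * e) q != 0 -> qpochoo (Q * e) q != 0 ->
  qpochoo (a * z) q != 0 -> qpochoo (b * z) q != 0 ->
  qpochoo (P * e) q * qpochoo (Q * e) q / qpochoo e q *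
    limn (series (phi32_term a b P Q z e)) =
  qpochoo (a * z) q * qpochoo (b * z) q / qpochoo z q *
    limn (series (phi32_term P Q a b e z)).
Proof.
have scale a' b' P' Q' z' e' : `|z'| < 1 -> `|e'| < 1 ->
    qpochoo (P' * e') q != 0 -> qpochoo (Q' * e') q != 0 ->
    qpochoo (P' * e') q * qpochoo (Q' * e') q / qpochoo e' q *
      limn (series (phi32_term a' b' P' Q' z' e')) =
    limn (series (fun n => qcoef q a' b' n * z' ^+ n *
      (qpochoo (P' * (e' * q ^+ n)) q * qpochoo (Q' * (e' * q ^+ n)) q
        / qpochoo (e' * q ^+ n) q))).
  move=> z1 e1 Pe0 Qe0; rewrite -lim_series_mull; last exact: is_cvg_phi32.
  congr (limn (series _)); apply/funext => n; rewrite /phi32_term (mulrA P') (mulrA Q').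
  have e0 := qpochoo_neq0 C_complete q_lt1 e1.
  move: Pe0 Qe0 e0; rewrite (qpochooD C_complete q_lt1 (P' * e') n).
  rewrite (qpochooD C_complete q_lt1 (Q' * e') n) (qpochooD C_complete q_lt1 e' n).
  rewrite !mulf_eq0 !negb_or => /andP[p1 p2] /andP[q1 q2] /andP[e2 e3].
  by field; rewrite p1 q1 e2 e3.
move=> z1 e1 bal Pe0 Qe0 az0 bz0; rewrite !scale//.
exact: gauss_double_sum.
Qed.

Hypothesis q_neq0 : q != 0.

(** For [n >= m] the symbol is the tail of a product starting at [x q^-m]; for [n < m]
    it is the inverse of the end of the same product. *)
Lemma qpoch_shift x m n : qpochn (x / q ^+ m) q m != 0 ->
  qpoch x q (- m%:Z + n%:Z) =
  qpochn (x / q ^+ m) q n / qpochn (x / q ^+ m) q m.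
Proof.
move=> x0; have qm0 := expf_neq0 m q_neq0.
have [mn|nm] := leqP m n.
  have -> : - m%:Z + n%:Z = (n - m)%N%:Z by rewrite addrC subzn.
  rewrite /= -{2}(subnK mn) addnC qpochnD divfK//.
  by rewrite mulrAC divff// mul1r.
have [j mE] : exists j, m = (n + j.+1)%N.
  by exists (m - n).-1; rewrite prednK ?subn_gt0// subnKC// ltnW.
have -> : - m%:Z + n%:Z = Negz j by rewrite mE NegzE PoszD; ring.
move: x0; rewrite /= {}mE in qm0 *; rewrite qpochnD mulf_eq0 negb_or => /andP[x1 x2].
have -> : x * q ^ (Negz j) = x / q ^+ (n + j.+1) * q ^+ n.
  by rewrite NegzE -exprnN exprD; field; rewrite !expf_neq0.
by field; rewrite x1 x2.
Qed.

Lemma qpoch_defE x m : qpoch_def x q (- m%:Z) = (qpochn (x / q ^+ m) q m != 0).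
Proof. by case: m => [|m] //=; rewrite qpochn0 oner_neq0. Qed.

(** Reversing the product and factoring [- x q^-(i+1)] out of each factor.  The middle
    factor does not depend on [x], so it cancels between two numerator and two
    denominator symbols. *)
Lemma qpochn_reflect x m : x != 0 -> qpochn (x / q ^+ m) q m =
  x ^+ m * (\prod_(i < m) - (q ^+ i.+1)^-1) * qpochn (q / x) q m.
Proof.
move=> x0; rewrite -[in x ^+ m](card_ord m) -prodr_const /qpochn -!big_split /=.
rewrite (reindex_inj rev_ord_inj); apply: eq_bigr => i _ /=.
have -> : q ^+ m = q ^+ (m - i.+1) * q ^+ i.+1 by rewrite -exprD subnK.
by rewrite exprS; field; rewrite x0 q_neq0 !expf_neq0.
Qed.


Lemma qpochs3 x y z (k : int) : qpochs [:: x; y; z] q k = qpoch x q k * qpoch y q k * qpoch z q k.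
Proof. by rewrite /qpochs !big_cons big_nil mulr1 mulrA. Qed.

Lemma qpochoos3 x y z : qpochoos [:: x; y; z] q = qpochoo x q * qpochoo y q * qpochoo z q.
Proof. by rewrite /qpochoos !big_cons big_nil mulr1 mulrA. Qed.

(** The summand at [k = n - m] is a constant times a 3phi2 summand, since the symbol
    with parameter [q^(1+m)] becomes [(q;q)_n] up to a constant. *)
Lemma qratio_shift a b y c d m :
  (forall k : int, - m%:Z <= k ->
     qratio_def [:: a; b; y] [:: c; d; q ^+ (1 + m)] q k) ->
  [/\ qpochn (a / q ^+ m) q m != 0, qpochn (b / q ^+ m) q m != 0,
      qpochn (y / q ^+ m) q m != 0, qpochoo (c / q ^+ m) q != 0
    & qpochoo (d / q ^+ m) q != 0] /\
  forall n, qratio [:: a; b; y] [:: c; d; q ^+ (1 + m)] q (- m%:Z + n%:Z) =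
    qpochn (c / q ^+ m) q m * qpochn (d / q ^+ m) q m * qpochn q q m /
      (qpochn (a / q ^+ m) q m * qpochn (b / q ^+ m) q m * qpochn (y / q ^+ m) q m) *
    (qcoef q (a / q ^+ m) (b / q ^+ m) n *
      (qpochn (y / q ^+ m) q n / (qpochn (c / q ^+ m) q n * qpochn (d / q ^+ m) q n))).
Proof.
move=> hdef; have := hdef _ (lexx _); rewrite /qratio_def /= !qpoch_defE !andbT.
move=> /and3P[/and3P[a0 b0 y0] /and3P[c0 d0 q0] _].
have qE : q ^+ (1 + m) / q ^+ m = q by rewrite addnC exprD expr1 mulrAC divff ?mul1r// expf_neq0.
rewrite qE in q0.
have nz n : [/\ qpochn (c / q ^+ m) q n != 0 & qpochn (d / q ^+ m) q n != 0].
  have /hdef/and3P[_ _ +] : - m%:Z <= - m%:Z + n%:Z by rewrite lerDl.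
  rewrite qpochs3 !mulf_eq0 !negb_or !qpoch_shift// => [/andP[]|]; last by rewrite qE.
  by rewrite !mulf_eq0 !negb_or => /andP[/andP[-> _] /andP[-> _]].
split.
  by split=> //; apply: qpochoo_neq0_qpochn => // n; case: (nz n).
move=> n; have [cn dn] := nz n; rewrite /qratio !qpochs3 !qpoch_shift ?qE// /qcoef.
by field; rewrite a0 b0 y0 c0 d0 q0 cn dn qpochn_neq0.
Qed.

(** After the shift, the constants on the two sides agree because of the balance
    [(abz/c) (abz/d) = ab * z / e] and the reflection of the four symbols with parameters
    [A], [B], [P], [Q]. *)
Lemma phi32_transform_shifted m a b c d z
    (a_neq0 : a != 0) (b_neq0 : b != 0) (c_neq0 : c != 0) (d_neq0 : d != 0)
    (z_neq0 : z != 0)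
    (lhs_def : forall k : int, - m%:Z <= k ->
       qratio_def [:: a; b; c * d * q ^+ m / (a * b * z)]
                  [:: c; d; q ^+ (1 + m)] q k)
    (prod_def : qpochoos [:: c; d; z] q != 0)
    (rhs_def : forall k : int, - m%:Z <= k ->
       qratio_def [:: a * b * z / c; a * b * z / d; z * q ^+ m]
                  [:: a * z; b * z; q ^+ (1 + m)] q k)
    (z_lt1 : `|z| < 1) (e_lt1 : `|c * d / (a * b * z)| < 1) :
  let f (k : int) : C :=
    qratio [:: a; b; c * d * q ^+ m / (a * b * z)]
           [:: c; d; q ^+ (1 + m)] q k * z ^ k in
  let g (k : int) : C :=
    qratio [:: a * b * z / c; a * b * z / d; z * q ^+ m]
           [:: a * z; b * z; q ^+ (1 + m)] q k
      * (c * d / (a * b * z)) ^ k in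
  [/\ zsummable (- m%:Z) f, zsummable (- m%:Z) g
    & zsum (- m%:Z) f =
        qpochoos [:: a * z; b * z; c * d / (a * b * z)] q
          / qpochoos [:: c; d; z] q
        * qratio [:: c * q / (a * b * z); d * q / (a * b * z); z]
                 [:: q / a; q / b; c * d / (a * b * z)] q m%:Z
        * zsum (- m%:Z) g].
Proof.
move=> f g; set e := c * d / (a * b * z) in e_lt1 g *.
pose p := q ^+ m; have p0 : p != 0 := expf_neq0 m q_neq0.
have e_neq0 : e != 0 by rewrite /e !mulf_neq0 ?invr_eq0 ?mulf_neq0.
have [[A0 B0 E0 C0 D0] fE] := qratio_shift lhs_def.
have [[Q0 P0 Z0 Az0 Bz0] gE] := qratio_shift rhs_def.
rewrite -/p in A0 B0 E0 C0 D0 fE Q0 P0 Z0 Az0 Bz0 gE.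
have eE : c * d * p / (a * b * z) / p = e.
  by rewrite /e; field; rewrite p0 a_neq0 b_neq0 z_neq0.
have zE : z * p / p = z by rewrite mulfK.
rewrite eE in E0 fE; rewrite zE in Z0 gE.
pose A := a / p; pose B := b / p; pose Q := a * b * z / c / p; pose P := a * b * z / d / p.
have PeE : P * e = c / p.
  by rewrite /P /e; field; rewrite p0 a_neq0 b_neq0 z_neq0 d_neq0.
have QeE : Q * e = d / p.
  by rewrite /Q /e; field; rewrite p0 a_neq0 b_neq0 z_neq0 c_neq0.
have AzE : A * z = a * z / p by rewrite /A mulrAC.
have BzE : B * z = b * z / p by rewrite /B mulrAC.
have bal : A * B * z = P * Q * e.
  by rewrite /A /B /P /Q /e; field; rewrite p0 a_neq0 b_neq0 z_neq0 c_neq0 d_neq0.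
pose F := phi32_term A B P Q z e; pose G := phi32_term P Q A B e z.
have cF : cvgn (series F) by apply: is_cvg_phi32; rewrite // ?PeE ?QeE.
have cG : cvgn (series G) by apply: is_cvg_phi32; rewrite // ?AzE ?BzE.
pose kf := qpochn (c / p) q m * qpochn (d / p) q m * qpochn q q m /
  (qpochn A q m * qpochn B q m * qpochn e q m) * z ^ (- m%:Z).
pose kg := qpochn (a * z / p) q m * qpochn (b * z / p) q m * qpochn q q m /
  (qpochn Q q m * qpochn P q m * qpochn z q m) * e ^ (- m%:Z).
have fs : zseries (- m%:Z) f = series (fun n => kf * F n).
  congr series; apply/funext => n; rewrite /f fE expfzDr// /F /phi32_term PeE QeE /kf -/A -/B.
  rewrite -exprnP; move: (qcoef _ _ _ _) (z ^ _) => u v; ring.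
have gs : zseries (- m%:Z) g = series (fun n => kg * G n).
  congr series; apply/funext => n; rewrite /g gE expfzDr// /G /phi32_term AzE BzE /kg.
  rewrite -/Q -/P /qcoef -exprnP; move: (e ^ _) => v; ring.
rewrite /zsummable /zsum fs gs; split.
- exact: (@is_cvg_seriesZ _ F kf cF).
- exact: (@is_cvg_seriesZ _ G kg cG).
rewrite !lim_series_mull//.
have := phi32_transform z_lt1 e_lt1 bal.
rewrite PeE QeE AzE BzE -/F -/G => /(_ C0 D0 Az0 Bz0).
move: (limn (series F)) (limn (series G)) => SF SG.
have oo x := qpochooD C_complete q_lt1 (x / p) m.
rewrite !oo !divfK// => tr.
move: C0 D0; rewrite !oo !divfK// !mulf_eq0 !negb_or => /andP[cm0 c0] /andP[dm0 d0].
have e0 := qpochoo_neq0 C_complete q_lt1 e_lt1.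
have z0 := qpochoo_neq0 C_complete q_lt1 z_lt1.
(* The products at c/p, d/p, az/p, bz/p have been split at m, so that only the
   infinite products at c, d, az, bz of the statement remain. *)
have -> : SF = qpochoo e q * (qpochn (a * z / p) q m * qpochoo (a * z) q *
   (qpochn (b * z / p) q m * qpochoo (b * z) q) / qpochoo z q * SG) /
   (qpochn (c / p) q m * qpochoo c q * (qpochn (d / p) q m * qpochoo d q)).
  by rewrite -tr; field; rewrite cm0 c0 dm0 d0.
rewrite /qratio !qpochs3 !qpochoos3 /= /kf /kg.
have abz0 : a * b * z != 0 by rewrite !mulf_neq0.
have abzc0 : a * b * z / c != 0 by rewrite mulf_neq0 ?invr_eq0.
have abzd0 : a * b * z / d != 0 by rewrite mulf_neq0 ?invr_eq0.
have qc : q / (a * b * z / c) = c * q / (a * b * z) by rewrite invf_div mulrCA mulrA.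
have qd : q / (a * b * z / d) = d * q / (a * b * z) by rewrite invf_div mulrCA mulrA.
(* The four reflections share one factor, generalized to w below. *)
have rA : qpochn A q m = _ := qpochn_reflect m a_neq0.
have rB : qpochn B q m = _ := qpochn_reflect m b_neq0.
have rQ : qpochn Q q m = _ := qpochn_reflect m abzc0.
have rP : qpochn P q m = _ := qpochn_reflect m abzd0.
move: A0 B0 Q0 P0; rewrite -/A -/B -/Q -/P rA rB rQ rP qc qd.
move: (\prod_(i < m) _) => w; rewrite !mulf_eq0 !negb_or.
move=> /andP[/andP[am w0] u1] /andP[/andP[bm _] u2].
move=> /andP[/andP[_ _] v1] /andP[/andP[_ _] v2].
rewrite -!exprnN /e !expr_div_n !exprMn.
by field; rewrite !expf_neq0// Z0 v1 v2 w0 E0 u1 u2 z0 c0 d0 cm0 dm0.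
Qed.

End Transformation.

Theorem proposition3p2 (R : realType) (q : R[i]) (m : nat) (a b c d z : R[i])
    (q_neq0 : q != 0) (q_lt1 : `|q| < 1)
    (a_neq0 : a != 0) (b_neq0 : b != 0) (c_neq0 : c != 0) (d_neq0 : d != 0)
    (z_neq0 : z != 0)
    (lhs_def : forall k : int, - m%:Z <= k ->
       qratio_def [:: a; b; c * d * q ^+ m / (a * b * z)]
                  [:: c; d; q ^+ (1 + m)] q k)
    (prod_def : qpochoos [:: c; d; z] q != 0)
    (pref_def :
       qratio_def [:: c * q / (a * b * z); d * q / (a * b * z); z]
                  [:: q / a; q / b; c * d / (a * b * z)] q m%:Z)
    (rhs_def : forall k : int, - m%:Z <= k ->
       qratio_def [:: a * b * z / c; a * b * z / d; z * q ^+ m]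
                  [:: a * z; b * z; q ^+ (1 + m)] q k)
    (z_lt1 : `|z| < 1) (cdabz_lt1 : `|c * d / (a * b * z)| < 1) :
  let f (k : int) : R[i] :=
    qratio [:: a; b; c * d * q ^+ m / (a * b * z)]
           [:: c; d; q ^+ (1 + m)] q k * z ^ k in
  let g (k : int) : R[i] :=
    qratio [:: a * b * z / c; a * b * z / d; z * q ^+ m]
           [:: a * z; b * z; q ^+ (1 + m)] q k
      * (c * d / (a * b * z)) ^ k in
  [/\ zsummable (- m%:Z) f, zsummable (- m%:Z) g
    & zsum (- m%:Z) f =
        qpochoos [:: a * z; b * z; c * d / (a * b * z)] q
          / qpochoos [:: c; d; z] q
        * qratio [:: c * q / (a * b * z); d * q / (a * b * z); z]
                 [:: q / a; q / b; c * d / (a * b * z)] q m%:Z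
        * zsum (- m%:Z) g].
Proof.
exact: (phi32_transform_shifted (@complex_geometrically_complete R) q_lt1 q_neq0
  a_neq0 b_neq0 c_neq0 d_neq0 z_neq0 lhs_def prod_def rhs_def z_lt1 cdabz_lt1).
Qed.
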